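(* $m_2(n,R)=\min\{m_2(n,R_i/M_i): i\in[\ell]\}$.
   Context: $R$ is a finite commutative ring with identity $1\neq0$, written as $R=R_1\times\cdots\times R_\ell$ with $R_i$ finite local rings with maximal ideals $M_i$. Let $n\ge3$. For a commutative ring $S$, a set of vectors in $S^n$ is unimodular if the matrix having them as rows has a right inverse; an $m$-subspace of $S^n$ is a submodule with a basis of $m$ vectors forming a unimodular set; points are $1$-subspaces. A $k$-cap in $S^n$ is a set of $k$ points such that any $3$ of them span a $3$-subspace of $S^n$. $m_2(n,S)$ denotes the maximum number of points of a cap in $S^n$. *)

(* Defs.v *)
From HB Require Import structures.
From mathcomp Require Import all_boot all_order all_algebra.
From mathcomp Require Import generic_quotient ring_quotient.

Set Implicit Arguments.
Unset Strict Implicit.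
Unset Printing Implicit Defensive.

Import GRing.Theory.
Local Open Scope ring_scope.

Section IdealQuotientFinite.
Variables (R : finComNzRingType) (I : idealr R).

HB.instance Definition _ : isCountable {ideal_quot I} :=
  CanIsCountable (@reprK R {ideal_quot I}).
HB.instance Definition _ : isFinite {ideal_quot I} :=
  CanIsFinite (@reprK R {ideal_quot I}).
End IdealQuotientFinite.

(* The direct product R_0 x ... x R_l with componentwise operations; there are
   l.+1 >= 1 factors. *)
Definition prod_ring (l : nat) (R_ : 'I_l.+1 -> finComNzRingType) : Type :=
  {dffun forall i : 'I_l.+1, R_ i}.

Section ProductRing.
Variables (l : nat) (R_ : 'I_l.+1 -> finComNzRingType).
Notation P := (prod_ring R_).

HB.instance Definition _ := Finite.on P.

Definition prod_zero : P := [ffun i => 0].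
Definition prod_one : P := [ffun i => 1].
Definition prod_opp (x : P) : P := [ffun i => - x i].
Definition prod_add (x y : P) : P := [ffun i => x i + y i].
Definition prod_mul (x y : P) : P := [ffun i => x i * y i].

Fact prod_addA : associative prod_add.
Proof. by move=> x y z; apply/ffunP => i; rewrite !ffunE addrA. Qed.
Fact prod_addC : commutative prod_add.
Proof. by move=> x y; apply/ffunP => i; rewrite !ffunE addrC. Qed.
Fact prod_add0 : left_id prod_zero prod_add.
Proof. by move=> x; apply/ffunP => i; rewrite !ffunE add0r. Qed.
Fact prod_addN : left_inverse prod_zero prod_opp prod_add.
Proof. by move=> x; apply/ffunP => i; rewrite !ffunE addNr. Qed.

HB.instance Definition _ :=
  GRing.isZmodule.Build P prod_addA prod_addC prod_add0 prod_addN.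

Fact prod_mulA : associative prod_mul.
Proof. by move=> x y z; apply/ffunP => i; rewrite !ffunE mulrA. Qed.
Fact prod_mulC : commutative prod_mul.
Proof. by move=> x y; apply/ffunP => i; rewrite !ffunE mulrC. Qed.
Fact prod_mul1 : left_id prod_one prod_mul.
Proof. by move=> x; apply/ffunP => i; rewrite !ffunE mul1r. Qed.
Fact prod_mulDl : left_distributive prod_mul +%R.
Proof. by move=> x y z; apply/ffunP => i; rewrite !ffunE mulrDl. Qed.
Fact prod_1neq0 : prod_one != 0.
Proof.
by apply/eqP => /ffunP /(_ ord0); rewrite !ffunE => /eqP; rewrite oner_eq0.
Qed.

HB.instance Definition _ :=
  GRing.Zmodule_isComNzRing.Build P
    prod_mulA prod_mulC prod_mul1 prod_mulDl prod_1neq0.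
End ProductRing.

(* Elements of [idealr R] are proper ideals. *)
Definition maximal_ideal (R : finComNzRingType) (M : idealr R) : Prop :=
  forall J : idealr R,
    {subset (M : {pred R}) <= (J : {pred R})} ->
    (J : {pred R}) =i (M : {pred R}).

Definition local_ring_with (R : finComNzRingType) (M : idealr R) : Prop :=
  maximal_ideal M /\
  forall J : idealr R, maximal_ideal J -> (J : {pred R}) =i (M : {pred R}).

Section Caps.
Variables (n : nat) (S : finComNzRingType).
Implicit Types (U X : {set 'rV[S]_n}).

Definition submodule U : bool :=
  (0 \in U) &&
  [forall a : S, forall u in U, forall v in U, a *: u + v \in U].

Definition span_of X : {set 'rV[S]_n} :=
  \bigcap_(U : {set 'rV[S]_n} | submodule U && (X \subset U)) U.

Definition unimodular m (A : 'M[S]_(m, n)) : bool :=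
  [exists B : 'M[S]_(n, m), A *m B == 1%:M].

Definition is_basis m (A : 'M[S]_(m, n)) U : bool :=
  [forall x : 'rV[S]_m, (x *m A == 0) ==> (x == 0)] &&
  (U == span_of [set row i A | i : 'I_m]).

Definition subspace (m : nat) U : bool :=
  submodule U && [exists A : 'M[S]_(m, n), is_basis A U && unimodular A].

Definition point U : bool := subspace 1 U.

Definition cap (C : {set {set 'rV[S]_n}}) : bool :=
  [forall P in C, point P] &&
  [forall D : {set {set 'rV[S]_n}},
     (D \subset C) && (#|D| == 3)%N ==> subspace 3 (span_of (cover D))].

Definition m2 : nat := (\max_(C : {set {set 'rV[S]_n}} | cap C) #|C|)%N.
End Caps.

Definition min_ord (l : nat) (F : 'I_l.+1 -> nat) : nat :=
  \big[minn/F ord0]_(i < l.+1) F i.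

(* Main.v *)
Require Import Defs.
From HB Require Import structures.
From mathcomp Require Import all_boot all_order all_algebra.
From mathcomp Require Import generic_quotient ring_quotient zify.

(** A cap with [k >= 3] points amounts to a [k]-row matrix all of whose
    [3]-row submatrices are unimodular.  Ring morphisms preserve unimodularity,
    so caps of [R] map to caps of every residue ring [R_i / M_i].  Conversely
    unimodularity can be tested modulo the maximal ideal of a local ring (a
    square matrix whose determinant is [1] modulo [M] is invertible) and
    componentwise in a product, so equally large caps of all the residue rings
    lift and glue to a cap of [R]. *)

Set Implicit Arguments.
Unset Strict Implicit.
Unset Printing Implicit Defensive.

Import GRing.Theory.
Local Open Scope ring_scope.
Local Open Scope quotient_scope.

(** * Spans as row spaces, subspaces as row spaces of unimodular matrices *)

Section RowSpaces.
Variables (n : nat) (S : finComNzRingType).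
Implicit Types (U X : {set 'rV[S]_n}).

Definition row_space m (A : 'M[S]_(m, n)) : {set 'rV[S]_n} :=
  [set x *m A | x : 'rV[S]_m].

Lemma submoduleP U :
  reflect (0 \in U /\ forall a, {in U &, forall u v, a *: u + v \in U})
          (submodule U).
Proof.
apply: (iffP andP) => -[U0 UP]; split=> //.
  move=> a u v uU vU.
  by move/forallP/(_ a)/forall_inP/(_ u uU)/forall_inP: UP; apply.
apply/forallP=> a; apply/forall_inP=> u uU.
by apply/forall_inP=> v vU; apply: UP.
Qed.

Lemma row_space_submodule m (A : 'M[S]_(m, n)) : submodule (row_space A).
Proof.
apply/submoduleP; split=> [|a _ _ /imsetP[x _ ->] /imsetP[y _ ->]].
  by apply/imsetP; exists 0; rewrite // mul0mx.
by apply/imsetP; exists (a *: x + y); rewrite // mulmxDl scalemxAl.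
Qed.

Lemma row_in_row_space m (A : 'M[S]_(m, n)) i : row i A \in row_space A.
Proof. by apply/imsetP; exists (delta_mx 0 i); rewrite // -rowE. Qed.

Lemma row_space_min m (A : 'M[S]_(m, n)) U :
  submodule U -> (forall i, row i A \in U) -> row_space A \subset U.
Proof.
move=> /submoduleP[U0 UP] AU; apply/subsetP=> _ /imsetP[x _ ->].
rewrite mulmx_sum_row; elim/big_ind: _ => // [u v uU vU|i _].
  by rewrite -[u]scale1r UP.
by rewrite -[_ *: _]addr0 UP.
Qed.

Lemma span_of_row_space m (A : 'M[S]_(m, n)) X :
    X \subset row_space A ->
    (forall U, submodule U -> X \subset U -> forall i, row i A \in U) ->
  span_of X = row_space A.
Proof.
move=> XA minA; apply/eqP; rewrite eqEsubset; apply/andP; split.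
  by apply: bigcap_inf; rewrite row_space_submodule.
by apply/bigcapsP=> U /andP[Usub XU]; apply: row_space_min => //; apply: minA.
Qed.

Lemma span_of_rows m (A : 'M[S]_(m, n)) :
  span_of [set row i A | i : 'I_m] = row_space A.
Proof.
apply: span_of_row_space => [|U _ /subsetP AU i]; last exact/AU/imset_f.
by apply/subsetP=> _ /imsetP[i _ ->]; apply: row_in_row_space.
Qed.

(** This turns the span of a union of points, as in the definition of a cap, into the row space of
    the matrix of their generators. *)
Lemma span_of_row_spaces m (A : 'M[S]_(m, n)) :
  span_of (cover [set row_space (row i A) | i : 'I_m]) = row_space A.
Proof.
rewrite cover_imset; apply: span_of_row_space => [|U _ /bigcupsP AU i].
  apply/bigcupsP=> i _; apply: row_space_min => [|j].
    exact: row_space_submodule.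
  by rewrite ord1 row_id row_in_row_space.
apply: (subsetP (AU i isT)).
by have:= row_in_row_space (row i A) 0; rewrite row_id.
Qed.

Lemma unimodularP m (A : 'M[S]_(m, n)) :
  reflect (exists B, A *m B = 1%:M) (unimodular A).
Proof. exact: 'exists_eqP. Qed.

Lemma unimodular_free m (A : 'M[S]_(m, n)) (x : 'rV_m) :
  unimodular A -> x *m A = 0 -> x = 0.
Proof.
by move=> /unimodularP[B AB] xA; rewrite -[x]mulmx1 -AB mulmxA xA mul0mx.
Qed.

(** A right inverse of [A] already forces its rows to be linearly independent, so a basis is just a
    unimodular matrix. *)
Lemma subspaceP m U :
  reflect (exists2 A : 'M[S]_(m, n), unimodular A & U = row_space A)
          (subspace m U).
Proof.
apply: (iffP andP) => [[_ /existsP[A /andP[/andP[_ /eqP->] Aunim]]]|[A Aunim ->]].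
  by exists A; rewrite // span_of_rows.
split; first exact: row_space_submodule.
apply/existsP; exists A; rewrite Aunim andbT; apply/andP; split.
  by apply/forallP=> x; apply/implyP=> /eqP/(unimodular_free Aunim)->.
by rewrite span_of_rows.
Qed.

Lemma eq_row_space_unimodular m (A B : 'M[S]_(m, n)) :
  row_space A = row_space B -> unimodular A -> unimodular B.
Proof.
move=> eqAB /unimodularP[C AC]; apply/unimodularP.
have /fin_all_exists[t tP] i : exists x : 'rV_m, row i A = x *m B.
  by have:= row_in_row_space A i; rewrite eqAB => /imsetP[x _ ->]; exists x.
pose T := \matrix_i t i.
have AE : A = T *m B by apply/row_matrixP=> i; rewrite row_mul rowK.
(* From [T *m (B *m C) = A *m C = 1] with both factors square, commutativity of the ring gives
   [(B *m C) *m T = 1]. *)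
by exists (C *m T); rewrite mulmxA mulmx1C // mulmxA -AE.
Qed.

Lemma unimodular_row m (A : 'M[S]_(m, n)) i :
  unimodular A -> unimodular (row i A).
Proof.
move=> /unimodularP[B AB]; apply/unimodularP; exists (col i B).
have -> : row i A *m col i B = row i (col i (A *m B)).
  by rewrite !colE -row_mul mulmxA.
by rewrite AB; apply/matrixP=> r s; rewrite !ord1 !mxE !eqxx.
Qed.

(** * Caps as matrices whose triples of rows are unimodular *)

Definition cap_mx k (F : 'M[S]_(k, n)) : Prop :=
  forall g : 'I_3 -> 'I_k, injective g -> unimodular (rowsub g F).

(** Choose a generator of each point. Three of them span a [3]-subspace, which has some unimodular
    basis matrix, and unimodularity depends only on the row space. *)
Lemma cap_mx_of_cap (C : {set {set 'rV[S]_n}}) :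
  cap C -> exists F : 'M[S]_(#|C|, n), cap_mx F.
Proof.
case/andP=> /forall_inP Cpt /forallP Ccap.
have /fin_all_exists[f fP] (i : 'I_#|C|) :
    exists v : 'rV[S]_n, enum_val i = row_space v.
  by have /subspaceP[v _ ->] := Cpt _ (enum_valP i); exists v.
exists (\matrix_i f i) => g gI; set A := rowsub _ _.
have linesE : [set enum_val (g r) | r : 'I_3] =
              [set row_space (row r A) | r : 'I_3].
  by apply: eq_imset => r; rewrite fP row_rowsub rowK.
have := Ccap [set enum_val (g r) | r : 'I_3].
rewrite {3}linesE span_of_row_spaces => /implyP/(_ _)/subspaceP[|B Bunim eqB].
  apply/andP; split.
    by apply/subsetP=> _ /imsetP[r _ ->]; apply: enum_valP.
  by rewrite card_imset ?card_ord // => r s /enum_val_inj/gI.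
exact: eq_row_space_unimodular (esym eqB) Bunim.
Qed.

Lemma exists_inj_triple k (i j : 'I_k) : (3 <= k)%N -> i != j ->
  exists g : 'I_3 -> 'I_k, [/\ injective g, g 0 = i & g 1 = j].
Proof.
move=> k3 ij.
have /card_gt0P[l] : (0 < #|~: [set i; j]|)%N.
  by have := cardsC [set i; j]; rewrite cards2 ij card_ord; lia.
rewrite !inE negb_or => /andP[li lj].
have uniq_ijl : uniq [:: i; j; l].
  by rewrite /= !inE negb_or ij eq_sym li eq_sym lj.
exists (fun r => nth i [:: i; j; l] r); split=> // r s /eqP.
by rewrite nth_uniq // => /eqP/val_inj.
Qed.

Section CapOfMatrix.
Variables (k : nat) (F : 'M[S]_(k, n)).
Hypotheses (k3 : (3 <= k)%N) (Fcap : cap_mx F).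
Let line i := row_space (row i F).

Lemma cap_mx_line_inj : injective line.
Proof.
move=> i j eq_ij; apply/eqP/negPn/negP => neq_ij.
have [g [gI g0 g1]] := exists_inj_triple k3 neq_ij.
have /imsetP[a _ rowi] : row i F \in line j.
  by rewrite -eq_ij /line; have:= row_in_row_space (row i F) 0; rewrite row_id.
(* If row [i] is a multiple of row [j], these coefficients give a linear relation on a unimodular
   triple, so they vanish; but the first one is [1]. *)
have : delta_mx 0 0 - a 0 0 *: delta_mx 0 1 = 0 :> 'rV[S]_3.
  apply: unimodular_free (Fcap gI) _.
  rewrite mulmxBl -scalemxAl -!rowE !row_rowsub g0 g1 rowi.
  by rewrite {1}[a]mx11_scalar mul_scalar_mx subrr.
move/rowP/(_ 0); rewrite !mxE /= mulr0 subr0 => /eqP.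
by rewrite oner_eq0.
Qed.

Lemma cap_of_cap_mx : cap [set line i | i : 'I_k].
Proof.
apply/andP; split.
  apply/forall_inP=> _ /imsetP[i _ ->]; apply/subspaceP; exists (row i F) => //.
  have [j neq_ij] : exists j, i != j.
    have /card_gt0P[j] : (0 < #|~: [set i]|)%N.
      by have := cardsC [set i]; rewrite cards1 card_ord; lia.
    by rewrite !inE eq_sym; exists j.
  have [g [gI g0 _]] := exists_inj_triple k3 neq_ij.
  by have := unimodular_row 0 (Fcap gI); rewrite row_rowsub g0.
apply/forallP=> D; apply/implyP=> /andP[/subsetP DC /eqP D3].
have /fin_all_exists[g gP] (r : 'I_3) :
    exists i, enum_val (cast_ord (esym D3) r) = line i.
  by have /imsetP[i _ ->] := DC _ (enum_valP (cast_ord (esym D3) r)); exists i.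
have gI : injective g.
  move=> r s grs; apply: (@cast_ord_inj _ _ (esym D3)); apply: enum_val_inj.
  by rewrite !gP grs.
apply/subspaceP; exists (rowsub g F); first exact: Fcap.
(* The lines of the chosen rows form a subset of [D], and both sets have three elements. *)
rewrite -span_of_row_spaces; congr (span_of (cover _)); apply/eqP.
rewrite eq_sym eqEcard D3 card_imset ?card_ord ?leqnn ?andbT.
  apply/subsetP=> _ /imsetP[r _ ->].
  by rewrite row_rowsub -[row_space _]gP enum_valP.
by move=> r s; rewrite !row_rowsub => /cap_mx_line_inj/gI.
Qed.
End CapOfMatrix.

(** The rows of a cap matrix give [k] distinct points of a cap; conversely, the first [k] points of
    a largest cap give the matrix. *)
Lemma leq_m2P k : (3 <= k)%N ->
  (k <= m2 n S)%N <-> exists F : 'M[S]_(k, n), cap_mx F.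
Proof.
move=> k3; split=> [|[F Fcap]]; last first.
  rewrite -[k in (k <= _)%N]card_ord -cardsT.
  rewrite -(card_imset _ (cap_mx_line_inj k3 Fcap)).
  rewrite (_ : _ @: _ = [set row_space (row i F) | i : 'I_k]).
    by apply: leq_bigmax_cond; apply: cap_of_cap_mx.
  by apply/setP=> P; apply/imsetP/imsetP => -[i _ ->]; exists i.
have [C Ccap ->] : {C : {set {set 'rV[S]_n}} | cap C & m2 n S = #|C|}.
  (* The empty set is a cap, so the maximum is attained. *)
  apply: eq_bigmax_cond; apply/card_gt0P; exists set0; apply/andP; split.
    by apply/forall_inP=> P; rewrite inE.
  apply/forallP=> D; apply/implyP=> /andP[].
  by rewrite subset0 => /eqP->; rewrite cards0.
have [F Fcap] := cap_mx_of_cap Ccap => leC.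
exists (rowsub (widen_ord leC) F) => g gI.
rewrite -rowsub_comp; apply: Fcap => r s /= /(congr1 val) /= /val_inj; exact: gI.
Qed.

Lemma m2_ge3 : (3 <= n)%N -> (3 <= m2 n S)%N.
Proof.
(* The first three standard basis vectors form a cap matrix. *)
move=> n3; apply/leq_m2P => //; exists (pid_mx 3) => g gI.
apply/unimodularP; exists (colsub g (pid_mx 3)).
rewrite -mxsub_mul pid_mx_id // pid_mx_1.
by apply/matrixP=> i j; rewrite !mxE (inj_eq gI).
Qed.

End RowSpaces.

(** * Images of cap matrices under ring morphisms *)

Lemma unimodular_map (S T : finComNzRingType) (f : {rmorphism S -> T}) m n
    (A : 'M[S]_(m, n)) :
  unimodular A -> unimodular (map_mx f A).
Proof.
move=> /unimodularP[B AB]; apply/unimodularP; exists (map_mx f B).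
by rewrite -map_mxM AB map_mx1.
Qed.

Lemma cap_mx_map (S T : finComNzRingType) (f : {rmorphism S -> T}) k n
    (F : 'M[S]_(k, n)) :
  cap_mx F -> cap_mx (map_mx f F).
Proof.
by move=> Fcap g gI; rewrite -map_mxsub; apply/unimodular_map/Fcap.
Qed.

(** * Lifting from the residue ring of a local ring *)

Section LocalRing.
Variables (S : finComNzRingType) (M : idealr S).
Hypothesis Mlocal : local_ring_with M.

(** Proper ideals as a boolean predicate on finite sets, so that a maximal one can be obtained from
    [maxset_exists]. *)
Definition ideal_set (J : {set S}) : bool :=
  [&& 0 \in J, 1 \notin J &
      [forall a, forall u in J, forall v in J, a * u + v \in J]].

Lemma ideal_setP (J : {set S}) :
  reflect (idealr_closed (mem J)) (ideal_set J).
Proof.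
apply: (iffP and3P) => -[J0 J1 JP]; split=> //.
  move=> a u v uJ vJ.
  by move/forallP/(_ a)/forall_inP/(_ u uJ)/forall_inP: JP; apply.
apply/forallP=> a; apply/forall_inP=> u uU.
by apply/forall_inP=> v vU; apply: JP.
Qed.

Lemma idealr_of_set (J : {set S}) : ideal_set J ->
  exists K : idealr S, (K : {pred S}) =i J.
Proof.
move=> /ideal_setP JP.
pose K := fun x : S => x \in J.
have KP : idealr_closed K := JP.
pose inst := isIdealr.Build S K KP.
pose KI : idealr S := HB.pack K inst.
by exists KI.
Qed.

(** If [x] is not a unit, the multiples of [x] form a proper ideal; it lies in a maximal ideal,
    which can only be [M]. *)
Lemma local_ring_unit x : x \notin M -> exists y, x * y = 1.
Proof.
move=> xM.
have [/existsP[y /eqP]|/existsPn xN1] := boolP [exists y, x * y == 1].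
  by exists y.
pose xS := [set x * y | y : S].
have xS_ideal : ideal_set xS.
  apply/ideal_setP; split; first by apply/imsetP; exists 0; rewrite ?mulr0.
    by apply/imsetP=> -[y _ /esym/eqP]; apply/negP.
  move=> a _ _ /imsetP[y _ ->] /imsetP[z _ ->]; apply/imsetP.
  by exists (a * y + z); rewrite // mulrDr mulrCA.
have [J /maxsetP[Jid Jmax] xJ] := maxset_exists xS_ideal.
have [K KJ] := idealr_of_set Jid.
case/negP: xM; rewrite -(Mlocal.2 K) => [|L KL y].
  by rewrite KJ (subsetP xJ) //; apply/imsetP; exists 1; rewrite ?mulr1.
have L_ideal : ideal_set [set z | z \in L].
  apply/ideal_setP; split=> [||a u v]; rewrite !inE ?rpred0 ?idealr1 //.
  by move=> uL vL; rewrite rpredD ?idealMr.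
rewrite KJ -(Jmax _ L_ideal) ?inE //.
by apply/subsetP=> z zJ; rewrite inE KL ?KJ.
Qed.

(** Lift the right inverse entrywise to [C]. The determinant of [A *m C] is [1] modulo [M], hence a
    unit, and the adjugate corrects [C] to a right inverse of [A]. *)
Lemma unimodular_quot m n (A : 'M[S]_(m, n)) :
  unimodular (map_mx \pi_{ideal_quot M} A) -> unimodular A.
Proof.
move=> /unimodularP[B AB]; pose C := map_mx repr B.
have [d detd] : exists d, \det (A *m C) * d = 1.
  apply: local_ring_unit; apply/negP => detM.
  have : \pi_{ideal_quot M} (\det (A *m C)) = 1.
    rewrite -det_map_mx map_mxM -map_mx_comp.
    rewrite (_ : map_mx _ B = B) ?AB ?det1 //.
    by apply/matrixP=> i j; rewrite !mxE /= reprK.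
  rewrite -(rmorph1 \pi_{ideal_quot M}) => /eqP.
  rewrite -Quotient.idealrBE => det1M.
  (* The difference of the determinant and the determinant minus [1] puts [1] into the proper ideal
     [M]. *)
  have := rpredB detM det1M.
  by rewrite opprB addrC subrK idealr1.
apply/unimodularP; exists (C *m (d *: \adj (A *m C))).
by rewrite mulmxA -scalemxAr mul_mx_adj scale_scalar_mx mulrC detd.
Qed.

Lemma cap_mx_quot_lift k n (F : 'M[{ideal_quot M}]_(k, n)) :
  cap_mx F -> cap_mx (map_mx repr F : 'M[S]_(k, n)).
Proof.
move=> Fcap g gI; apply: unimodular_quot; rewrite map_mxsub -map_mx_comp.
rewrite (_ : map_mx _ F = F); first exact: Fcap.
by apply/matrixP=> i j; rewrite !mxE /= reprK.
Qed.

End LocalRing.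

(** * Gluing matrices over the factors of a product *)

Section Product.
Variables (l : nat) (R_ : 'I_l.+1 -> finComNzRingType).

Definition prod_proj i (x : prod_ring R_) : R_ i := x i.

Lemma prod_proj_zmod_morphism i : zmod_morphism (@prod_proj i).
Proof. by move=> x y; rewrite /prod_proj !ffunE. Qed.
Lemma prod_proj_monoid_morphism i : monoid_morphism (@prod_proj i).
Proof. by split=> [|x y]; rewrite /prod_proj !ffunE. Qed.

HB.instance Definition _ i :=
  GRing.isZmodMorphism.Build (prod_ring R_) (R_ i) (@prod_proj i)
    (@prod_proj_zmod_morphism i).
HB.instance Definition _ i :=
  GRing.isMonoidMorphism.Build (prod_ring R_) (R_ i) (@prod_proj i)
    (@prod_proj_monoid_morphism i).

Variables (R : finComNzRingType) (phi : {rmorphism R -> prod_ring R_}).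
Variable psi : prod_ring R_ -> R.
Hypotheses (phiK : cancel phi psi) (psiK : cancel psi phi).

Definition glue_mx m n (A_ : forall i, 'M[R_ i]_(m, n)) : 'M[R]_(m, n) :=
  \matrix_(r, s) psi [ffun i => A_ i r s].

Lemma glue_mxK m n (A_ : forall i, 'M[R_ i]_(m, n)) i :
  map_mx (@prod_proj i \o phi) (glue_mx A_) = A_ i.
Proof. by apply/matrixP=> r s; rewrite !mxE /= psiK /prod_proj ffunE. Qed.

Lemma prod_mx_inj m n (A B : 'M[R]_(m, n)) :
  (forall i, map_mx (@prod_proj i \o phi) A = map_mx (@prod_proj i \o phi) B) ->
  A = B.
Proof.
move=> eqAB; apply/matrixP=> r s; apply: (can_inj phiK); apply/ffunP=> i.
by have /matrixP/(_ r s) := eqAB i; rewrite !mxE.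
Qed.

(** The right inverses over the factors glue to one over [R], because equality of matrices is tested
    factor by factor. *)
Lemma unimodular_prod m n (A : 'M[R]_(m, n)) :
  (forall i, unimodular (map_mx (@prod_proj i \o phi) A)) -> unimodular A.
Proof.
move=> Aunim.
have AB_ i := xchooseP (existsP (Aunim i)).
apply/unimodularP; exists (glue_mx (fun i => xchoose (existsP (Aunim i)))).
by apply: prod_mx_inj => i; rewrite map_mxM glue_mxK (eqP (AB_ i)) map_mx1.
Qed.

Lemma cap_mx_glue k n (F_ : forall i, 'M[R_ i]_(k, n)) :
  (forall i, cap_mx (F_ i)) -> cap_mx (glue_mx F_).
Proof.
move=> Fcap g gI; apply: unimodular_prod => i.
by rewrite map_mxsub glue_mxK; apply: Fcap.
Qed.

End Product.

(** * The minimum over the factors, and the two inequalities *)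

Lemma leq_min_ord l (F : 'I_l.+1 -> nat) k :
  (k <= min_ord F)%N <-> forall i, (k <= F i)%N.
Proof.
split=> [le_k i|le_k].
  apply: leq_trans le_k _; rewrite /min_ord.
  elim: (index_enum _) (mem_index_enum i) => // j s IHs.
  rewrite inE big_cons geq_min => /predU1P[->|/IHs->]; last exact: orbT.
  by rewrite leqnn.
(* The initial value [F ord0] of the iterated minimum is itself one of the values bounded below by
   [k]. *)
by rewrite /min_ord; elim/big_ind: _ => // x y kx ky; rewrite leq_min kx.
Qed.

Theorem theorem6p5 (R : finComNzRingType) (l : nat)
  (R_ : 'I_l.+1 -> finComNzRingType)
  (M_ : forall i : 'I_l.+1, idealr (R_ i))
  (hlocal : forall i : 'I_l.+1, local_ring_with (M_ i))
  (phi : {rmorphism R -> prod_ring R_}) (hphi : bijective phi)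
  (n : nat) (hn : (3 <= n)%N) :
  m2 n R = min_ord (fun i : 'I_l.+1 => m2 n {ideal_quot (M_ i)}).
Proof.
case: hphi => psi phiK psiK.
apply/eqP; rewrite eqn_leq; apply/andP; split.
  (* A largest cap of [R] is pushed to the factor [R_ i] and then to its residue ring. *)
  apply/leq_min_ord => i; apply/leq_m2P; first exact: m2_ge3.
  have /(leq_m2P _ _ (m2_ge3 R hn))[F Fcap] := leqnn (m2 n R).
  by exists (map_mx \pi_{ideal_quot (M_ i)} (map_mx (@prod_proj _ _ i \o phi) F));
    do 2!apply: cap_mx_map.
set k := min_ord _.
have k3 : (3 <= k)%N by apply/leq_min_ord => i; apply: m2_ge3.
apply/(leq_m2P _ _ k3).
(* Each residue ring has a cap matrix with [k] rows; any representatives of its entries give one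
   over [R_ i]. *)
have F_ i : exists F : 'M[R_ i]_(k, n), cap_mx F.
  have /leq_min_ord/(_ i) := leqnn k.
  move=> /(leq_m2P _ _ k3)[F Fcap].
  by exists (map_mx repr F); apply: cap_mx_quot_lift.
have [G Gcap] := fin_all_exists F_.
by exists (glue_mx psi G); apply: (cap_mx_glue phiK psiK).
Qed.
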